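(* Let $\mathcal G$ be a $\Gamma$-periodic graph with fundamental graph $\mathcal G_*=(\mathcal V_*,\mathcal A_* )$, $\nu=\#\mathcal V_*$, and consider the Schrödinger operators $H=A+Q$ with $\Gamma$-periodic (complex-valued) potentials $Q$. (i) For every $n\in\mathbb N$ and $\mathrm m\in\mathbb Z^d$ the functional $$\mathcal I_n^{\mathrm m}(Q)=\sum_{\substack{r\in\{1,\dots,n\},\ \mathbf c\in\widetilde{\mathcal P}\setminus\mathcal P\\ r|\mathbf c|=n,\ r\tau(\mathbf c)=\mathrm m}}\frac1r\,\omega^r(\mathbf c,Q)$$ is a Floquet spectral invariant of $H$. Moreover, $\{\mathcal I_n^{\mathrm m}(Q):\ n\in\{1,\dots,\nu\},\ \mathrm m\in\mathbb Z^d\}$ is a complete system of Floquet spectral invariants of $H$. (ii) For every $n\in\mathbb N$ the functional $$\mathcal I_n(Q)=\sum_{\substack{r\in\{1,\dots,n\},\ \mathbf c\in\widetilde{\mathcal P}\setminus\mathcal P\\ r|\mathbf c|=n}}\frac1r\,\omega^r(\mathbf c,Q)$$ is a periodic spectral invariant of $H$, and $\{\mathcal I_n(Q):\ n\in\{1,\dots,\nu\}\}$ is a complete system of periodic spectral invariants of $H$.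
   Context: Let $\Gamma$ be a lattice of rank $d$ in $\mathbb R^d$ with basis $\mathfrak a_1,\dots,\mathfrak a_d$ and fundamental cell $\Omega=\{\sum_s x_s\mathfrak a_s: x_s\in[0,1)\}$. A $\Gamma$-periodic graph $\mathcal G=(\mathcal V,\mathcal E)$ is a connected, locally finite graph embedded in $\mathbb R^d$, invariant under translation by every $\mathfrak a\in\Gamma$, with finite quotient $\mathcal G_*=\mathcal G/\Gamma$; $\mathcal G$ has no loops, multiple edges are allowed. Each unoriented edge is counted with both orientations; $\mathcal A$ is the set of oriented edges and $\bar{\mathbf e}=(v,u)$ is the inverse of $\mathbf e=(u,v)$. The fundamental graph $\mathcal G_*=(\mathcal V_*,\mathcal A_* )$ has vertex set $\mathcal V/\Gamma$ and oriented edge set $\mathcal A/\Gamma$ (it may contain loops and multiple edges); $\nu=\#\mathcal V_*$. Every vertex is uniquely $v=v_0+[v]$ with $v_0\in\Omega$, $[v]\in\Gamma$; for $\mathbf e=(u,v)\in\mathcal A$ the edge index is $\tau(\mathbf e)=[v]_{\mathbb A}-[u]_{\mathbb A}\in\mathbb Z^d$, where $\mathbf x_{\mathbb A}$ denotes coordinates with respect to $\mathfrak a_1,\dots,\mathfrak a_d$; it is $\Gamma$-invariant, hence defines $\tau(\mathbf e)$ for $\mathbf e\in\mathcal A_*$, and $\tau(\bar{\mathbf e})=-\tau(\mathbf e)$. A $\Gamma$-periodic potential is a function $Q:\mathcal V_*\to\mathbb C$. For $k\in\mathbb T^d=\mathbb R^d/(2\pi\mathbb Z)^d$ the Floquet operator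 on $\ell^2(\mathcal V_* )\cong\mathbb C^\nu$ is $H(k)=A(k)+Q$, $(A(k)f)(v)=\sum_{\mathbf e=(v,u)\in\mathcal A_*}e^{i\langle\tau(\mathbf e),k\rangle}f(u)$, $(Qf)(v)=Q(v)f(v)$. The Floquet spectrum of $H=A+Q$ is the family $\{\sigma(A(k)+Q):k\in\mathbb T^d\}$; the periodic spectrum is $\sigma(A(0)+Q)$ (eigenvalues with multiplicity). A functional $\mathcal I(Q)$ is a Floquet (resp. periodic) spectral invariant if equality of the Floquet (resp. periodic) spectra of $A+Q_1$ and $A+Q_2$ implies $\mathcal I(Q_1)=\mathcal I(Q_2)$; a family $\{\mathcal I_s\}_{s\in S}$ is a complete system of Floquet (resp. periodic) spectral invariants if: the Floquet (resp. periodic) spectra of $A+Q_1$, $A+Q_2$ coincide iff $\mathcal I_s(Q_1)=\mathcal I_s(Q_2)$ for all $s\in S$. Paths, cycles: a path is $(\mathbf e_1,\dots,\mathbf e_n)$, $\mathbf e_j=(v_j,v_{j+1})$, of length $n$; closed if $v_{n+1}=v_1$; a closed path is prime if it is not the $r$-fold repetition of a closed path with $r\ge2$. A cycle $\mathbf c=[\mathbf e_1,\dots,\mathbf e_n]$ is the class of a closed path under cyclic permutations; prime cycle = class of a prime closed path; $|\mathbf c|=n$; index $\tau(\mathbf c)=\sum_j\tau(\mathbf e_j)$. The modified fundamental graph $\widetilde{\mathcal G}_*$ is $\mathcal G_*$ with one added loop $\mathbf e_v$ at each $v\in\mathcal V_*$, with $\tau(\mathbf e_v)=0$. The weight of a cycle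 $\mathbf c=[\mathbf e_1,\dots,\mathbf e_n]$ in $\widetilde{\mathcal G}_*$ is $\omega(\mathbf c,Q)=\prod_j\omega(\mathbf e_j)$, $\omega(\mathbf e)=1$ for $\mathbf e\in\mathcal A_*$, $\omega(\mathbf e_v)=Q(v)$. $\mathcal P$ and $\widetilde{\mathcal P}$ denote the sets of prime cycles in $\mathcal G_*$ and $\widetilde{\mathcal G}_*$. *)

(* Defs.v *)
From HB Require Import structures.
From mathcomp Require Import all_boot all_order all_algebra.
From mathcomp Require Import boolp reals trigo complex.
Set Implicit Arguments. Unset Strict Implicit. Unset Printing Implicit Defensive.
Import Order.TTheory GRing.Theory Num.Theory.
Local Open Scope ring_scope.

(* Vertex set V_* = 'I_nu ; oriented edge set A_* = E (finite);
   src/tgt : endpoints; tau : edge index in Z^d (row vector); bar : inversion. *)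
Record fund_graph (d nu : nat) := FundGraph {
  fg_E :> finType;
  fg_src : fg_E -> 'I_nu;
  fg_tgt : fg_E -> 'I_nu;
  fg_tau : fg_E -> 'rV[int]_d;
  fg_bar : fg_E -> fg_E }.

(* vertices of the periodic graph G are pairs (v, x) in V_* x Z^d,
   edge e of G_* lifts to edges (src e, x) -> (tgt e, x + tau e). *)
Inductive pg_reach d nu (G : fund_graph d nu) :
    'I_nu * 'rV[int]_d -> 'I_nu * 'rV[int]_d -> Prop :=
  | pg_refl p : pg_reach G p p
  | pg_step (e : G) x q : pg_reach G (fg_tgt e, x + fg_tau e) q ->
                          pg_reach G (fg_src e, x) q.

Definition periodic_graph_axioms d nu (G : fund_graph d nu) : Prop :=
  (forall e : G, fg_bar (fg_bar e) = e) /\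
  (forall e : G, fg_bar e <> e) /\
  (forall e : G, fg_src (fg_bar e) = fg_tgt e /\ fg_tgt (fg_bar e) = fg_src e) /\
  (forall e : G, fg_tau (fg_bar e) = - fg_tau e) /\
  (* G has no loops *)
  (forall e : G, fg_src e = fg_tgt e -> fg_tau e <> 0) /\
  (forall p q, pg_reach G p q).

Section Floquet.
Variables (R : realType) (d nu : nat) (G : fund_graph d nu).
Local Notation C := R[i].

Definition expi (t : R) : C := (cos t +i* sin t)%C.

Definition dotZR (m : 'rV[int]_d) (k : 'rV[R]_d) : R :=
  \sum_(s < d) (m 0 s)%:~R * k 0 s.

Definition adjA (k : 'rV[R]_d) : 'M[C]_nu :=
  \matrix_(v, u) \sum_(e : G | (fg_src e == v) && (fg_tgt e == u))
      expi (dotZR (fg_tau e) k).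

Definition potQ (Q : 'I_nu -> C) : 'M[C]_nu := \matrix_(v, u) ((v == u)%:R * Q v).

Definition floquetH (Q : 'I_nu -> C) (k : 'rV[R]_d) : 'M[C]_nu := adjA k + potQ Q.

(* Equality of spectra (eigenvalues with multiplicity) of square complex
   matrices = equality of characteristic polynomials (C is algebraically
   closed, so the char. polynomial is prod (X - lambda) over the eigenvalue
   multiset). *)
Definition same_spectrum (M1 M2 : 'M[C]_nu) : Prop := char_poly M1 = char_poly M2.

Definition floquet_isospectral (Q1 Q2 : 'I_nu -> C) : Prop :=
  forall k : 'rV[R]_d, same_spectrum (floquetH Q1 k) (floquetH Q2 k).

Definition periodic_isospectral (Q1 Q2 : 'I_nu -> C) : Prop :=
  same_spectrum (floquetH Q1 0) (floquetH Q2 0).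

(* oriented edges of the modified graph: inl e (an edge of G_* ), inr v (added loop e_v) *)
Definition medge : finType := (fg_E G + 'I_nu)%type.

Definition msrc (a : medge) : 'I_nu :=
  match a with inl e => fg_src e | inr v => v end.
Definition mtgt (a : medge) : 'I_nu :=
  match a with inl e => fg_tgt e | inr v => v end.
Definition mtau (a : medge) : 'rV[int]_d :=
  match a with inl e => fg_tau e | inr v => 0 end.
Definition mweight (Q : 'I_nu -> C) (a : medge) : C :=
  match a with inl e => 1 | inr v => Q v end.

Definition madj (a b : medge) : bool := mtgt a == msrc b.

Definition closed_path (s : seq medge) : bool := (size s > 0)%N && cycle madj s.

Definition prime_path (s : seq medge) : Prop :=
  closed_path s /\
  ~ (exists (q : seq medge) (r : nat), (1 < r)%N /\ closed_path q /\
        s = flatten (nseq r q)).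

(* a closed path of G~_* that is not a path of G_* (uses an added loop) *)
Definition uses_added_loop (s : seq medge) : bool := has (fun a : medge => if a is inr _ then true else false) s.

Definition cycle_of (l : nat) (t : l.-tuple medge) : {set l.-tuple medge} :=
  [set u : l.-tuple medge | `[< exists i : nat, val u = rot i (val t) >] ].

Definition PtildeMinusP (l : nat) : {set {set l.-tuple medge}} :=
  (@cycle_of l) @: [set t : l.-tuple medge |
                      `[< prime_path (val t) >] && uses_added_loop (val t)].

Definition path_weight (Q : 'I_nu -> C) (s : seq medge) : C :=
  \prod_(a <- s) mweight Q a.
Definition path_index (s : seq medge) : 'rV[int]_d := \sum_(a <- s) mtau a.

(* weight and index of a cycle: those of any representative closed path
   (they are invariant under cyclic permutation) *)
Definition cycle_weight (Q : 'I_nu -> C) l (c : {set l.-tuple medge}) : C :=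
  if [pick t in c] is Some t then path_weight Q (val t) else 0.
Definition cycle_index l (c : {set l.-tuple medge}) : 'rV[int]_d :=
  if [pick t in c] is Some t then path_index (val t) else 0.

Definition invI_m (n : nat) (m : 'rV[int]_d) (Q : 'I_nu -> C) : C :=
  \sum_(r < n.+1 | (0 < r)%N) \sum_(l < n.+1 | (r * l == n)%N)
     \sum_(c in PtildeMinusP l | cycle_index c *~ r == m)
        (r%:R)^-1 * cycle_weight Q c ^+ r.

Definition invI (n : nat) (Q : 'I_nu -> C) : C :=
  \sum_(r < n.+1 | (0 < r)%N) \sum_(l < n.+1 | (r * l == n)%N)
     \sum_(c in PtildeMinusP l)
        (r%:R)^-1 * cycle_weight Q c ^+ r.

End Floquet.

(* Main.v *)
(** A closed path of length n in the modified fundamental graph is, in exactly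
    one way, an r-fold repetition of a prime closed path of length n/r, and a
    prime cycle of length l consists of l closed paths. Hence n * I_n^m(Q) is the
    sum of the weights of the closed paths of length n and index m that use an
    added loop. The closed paths without added loops do not see Q, so
    tr H(k)^n = const(k) + n * \sum_m I_n^m(Q) e^{i<m,k>}. Distinct characters
    e^{i<m,k>} are linearly independent, so the numbers I_n^m(Q), m in Z^d, carry
    the same information as the function k |-> tr H(k)^n; and the traces of the
    first nu powers determine the characteristic polynomial by Newton's
    identities. The periodic case is the specialisation k = 0. *)

Require Import Defs.
From HB Require Import structures.
From mathcomp Require Import all_boot all_order all_algebra.
From mathcomp Require Import boolp reals trigo complex.
Set Implicit Arguments.
Unset Strict Implicit.
Unset Printing Implicit Defensive.
Import Order.TTheory GRing.Theory Num.Theory.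
Local Open Scope ring_scope.

(** * Newton's identities: power sums of the roots and coefficients of a split polynomial *)

Section PowerSums.
Variable F : fieldType.
Implicit Types (s t : seq F) (a : F).

Lemma deriv_prod_XsubC s (p := \prod_(a <- s) ('X - a%:P)) :
  p^`() = \sum_(a <- s) p %/ ('X - a%:P).
Proof.
rewrite {}/p; elim: s => [|b s IHs]; first by rewrite !big_nil derivC.
rewrite !big_cons derivM derivXsubC mul1r IHs mulKp ?polyXsubC_eq0 //.
congr (_ + _).
rewrite mulr_sumr; apply: eq_big_seq => a a_s.
by rewrite divp_mulA // dvdp_XsubCl root_prod_XsubC.
Qed.

(** Horner's recursion [q_j = p_(j+1) + a q_(j+1)], unrolled [m] times; the bound on [j + m] kills
    the remainder [q_(j+m)]. *)
Lemma coef_divp_XsubC n (p q : {poly F}) a m j :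
    p = ('X - a%:P) * q -> (size q <= n)%N -> (n <= j + m)%N ->
  q`_j = \sum_(k < m) p`_(j + k).+1 * a ^+ k.
Proof.
move=> p_def q_n; elim: m j => [|m IHm] j n_jm.
  by rewrite big_ord0 nth_default // (leq_trans q_n) // -(addn0 j).
rewrite big_ord_recl addn0 mulr1 {1}p_def mulrBl coefB coefXM coefCM /=.
rewrite (eq_bigr (fun k : 'I_m => a * (p`_(j.+1 + k).+1 * a ^+ k))) => [|k _].
  by rewrite -mulr_sumr -IHm ?addSnnS // subrK.
by rewrite exprS mulrCA addSnnS.
Qed.

(* Newton's identities, read off coefficientwise from
   [size s * p = 'X * p' - \sum_a a * (p / ('X - a))]. *)
Lemma newton_prod_XsubC s j (p := \prod_(a <- s) ('X - a%:P)) :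
    (j <= size s)%N ->
  p`_j *+ (size s - j) =
    - \sum_(k < size s - j) p`_(j + k).+1 * \sum_(a <- s) a ^+ k.+1.
Proof.
move=> j_s; set n := size s in j_s *.
have p_div a : a \in s -> p = ('X - a%:P) * (p %/ ('X - a%:P)).
  by move=> a_s; rewrite mulrC divpK // dvdp_XsubCl root_prod_XsubC.
have size_q a : a \in s -> (size (p %/ ('X - a%:P))%R <= n)%N.
  move=> a_s.
  by rewrite size_divp ?polyXsubC_eq0 // size_prod_XsubC size_XsubC subn1.
have np : p *+ n = 'X * p^`() - \sum_(a <- s) a *: (p %/ ('X - a%:P)).
  have -> : p *+ n = \sum_(a <- s) p.
    by rewrite big_const_seq count_predT iter_addr_0.
  rewrite deriv_prod_XsubC mulr_sumr -sumrB; apply: eq_big_seq => a a_s.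
  by rewrite {1}(p_div a a_s) mulrBl mul_polyC.
have := congr1 (fun q : {poly F} => q`_j) np.
rewrite coefMn coefB coefXM coef_deriv coef_sum.
have -> : (if j == 0 then 0 else p`_j.-1.+1 *+ j.-1.+1) = p`_j *+ j by case: (j).
move=> np_j; rewrite mulrnBr // np_j addrC addKr; congr (- _).
under [RHS]eq_bigr do rewrite mulr_sumr.
rewrite exchange_big; apply: eq_big_seq => a a_s; rewrite coefZ.
rewrite (@coef_divp_XsubC n p _ a (n - j)) ?size_q ?subnKC //; last exact: p_div.
by rewrite mulr_sumr; apply: eq_bigr => k _; rewrite exprS mulrCA.
Qed.

(** Strong induction on the codegree [m]: Newton's identity gives [m] times the coefficient in terms
    of coefficients of smaller codegree and power sums of exponent at most [m]; in characteristic
    zero [m] can be cancelled. *)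
Lemma prod_XsubC_power_sums s t : size s = size t ->
    (forall k, (1 <= k <= size s)%N ->
       \sum_(a <- s) a ^+ k = \sum_(a <- t) a ^+ k) ->
    [pchar F] =i pred0 ->
  \prod_(a <- s) ('X - a%:P) = \prod_(a <- t) ('X - a%:P).
Proof.
move=> st_size st_sums F0.
set p := LHS; set q := RHS.
suff pq_coef m : (m <= size s)%N -> p`_(size s - m) = q`_(size s - m).
  apply/polyP => i; have [i_s|s_i] := leqP i (size s).
    by rewrite -(subKn i_s) pq_coef ?leq_subr.
  by rewrite !nth_default // size_prod_XsubC -?st_size.
elim/ltn_ind: m => m IHm m_s; set j := (size s - m)%N.
have sj : (size s - j)%N = m by rewrite subKn.
have j_s : (j <= size s)%N by rewrite leq_subr.
have [m0|m_gt0] := posnP m.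
  rewrite /j m0 subn0.
  have := lead_coef_prod_XsubC s xpredT id.
  have := lead_coef_prod_XsubC t xpredT id.
  by rewrite !lead_coefE !size_prod_XsubC /= -st_size => -> ->.
have m_nz : m%:R != 0 :> F by rewrite ((GRing.pcharf0P F).1 F0) -lt0n.
apply: (mulIf m_nz); rewrite !mulr_natr.
rewrite -[in LHS]sj -[in RHS]sj (@newton_prod_XsubC s) //.
rewrite [in RHS]st_size (@newton_prod_XsubC t) -?st_size //.
rewrite sj; congr (- _); apply: eq_bigr => k _; congr (_ * _); last first.
  by apply: st_sums; rewrite /= (leq_trans (ltn_ord k)).
have -> : (j + k).+1 = (size s - (m - k.+1))%N.
  by rewrite -addnS /j -[in RHS](subnK m_s) -addnBA ?leq_subr // subKn.
by apply: IHm; [rewrite ltn_subrL | rewrite (leq_trans (leq_subr _ _))].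
Qed.

End PowerSums.

(** * Powers of triangular matrices; conjugation *)

Section Similarity.
Variable F : fieldType.

Lemma trig_mx_expr n (A : 'M[F]_n) k : is_trig_mx A ->
  is_trig_mx (A ^+ k) /\ forall i, (A ^+ k) i i = A i i ^+ k.
Proof.
move=> /is_trig_mxP A_trig; elim: k => [|k [/is_trig_mxP IHt IHd]].
  split=> [|i]; last by rewrite expr0 mxE eqxx.
  by apply/is_trig_mxP => i j ij; rewrite expr0 mxE -val_eqE ltn_eqF.
rewrite exprS; split=> [|i].
  apply/is_trig_mxP => i j ij; rewrite mxE big1 // => l _.
  have [li|il] := leqP l i; last by rewrite A_trig ?mul0r.
  by rewrite IHt ?mulr0 ?(leq_ltn_trans li).
rewrite mxE (bigD1 i) //= IHd -exprS big1 ?addr0 // => l li.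
have [il|li'] := ltnP i l; first by rewrite A_trig ?mul0r.
by rewrite IHt ?mulr0 // ltn_neqAle li' andbT.
Qed.

Lemma char_poly_conj n (P A : 'M[F]_n) : P \in unitmx ->
  char_poly (P *m A *m invmx P) = char_poly A.
Proof.
move=> P_unit.
have PPV : map_mx (@polyC F) P *m map_mx (@polyC F) (invmx P) = 1%:M.
  by rewrite -map_mxM mulmxV // map_mx1.
have -> : char_poly (P *m A *m invmx P) =
    \det (map_mx (@polyC F) P *m char_poly_mx A *m map_mx (@polyC F) (invmx P)).
  rewrite /char_poly /char_poly_mx mulmxBr mulmxBl -!map_mxM.
  by rewrite scalar_mxC -[_%:M *m _ *m _]mulmxA PPV mulmx1.
by rewrite !det_mulmx mulrAC -det_mulmx PPV det1 mul1r.
Qed.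

Lemma conjmx_expr n (P A : 'M[F]_n) k : P \in unitmx ->
  (P *m A *m invmx P) ^+ k = P *m A ^+ k *m invmx P.
Proof.
move=> P_unit; elim: k => [|k IHk]; first by rewrite !expr0 mulmx1 mulmxV.
by rewrite !exprS IHk -!mulmxE !mulmxA mulmxKV.
Qed.

End Similarity.

(** * Characteristic polynomials versus traces of powers *)

Section Spectrum.
Variable C : numClosedFieldType.

(** The list is the diagonal of a Schur triangular form [T]: it gives the roots of the
    characteristic polynomial, and the diagonal of [T ^+ k] consists of the [k]-th powers. *)
Lemma eigenvalue_seq n (A : 'M[C]_n) : exists s : seq C,
  [/\ size s = n, char_poly A = \prod_(a <- s) ('X - a%:P) &
      forall k, \tr (A ^+ k) = \sum_(a <- s) a ^+ k].
Proof.
have [P P_unit T_trig] : exists2 P : 'M[C]_n,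
    P \in unitmx & is_trig_mx (P *m A *m invmx P).
  case: n A => [|n] A.
    by exists 1%:M; [exact: unitmx1 | apply/is_trig_mxP => -[]].
  have [//|P /spectral.unitarymx_unit P_unit] := spectral.Schur A.
  by exists P => //; rewrite -conjumx.
set T := P *m A *m _ in T_trig.
exists [seq T i i | i <- enum 'I_n]; split.
- by rewrite size_map size_enum_ord.
- by rewrite -(char_poly_conj A P_unit) char_poly_trig // big_map big_enum.
move=> k; rewrite big_map big_enum /=.
rewrite -[LHS](_ : \tr (T ^+ k) = _); last first.
  by rewrite conjmx_expr // mxtrace_mulC mulmxA mulVmx ?mul1mx.
by apply: eq_bigr => i _; have [_ ->] := trig_mx_expr k T_trig.
Qed.

Lemma char_poly_eq_mxtrace_expr n (A B : 'M[C]_n) :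
  (forall k, (1 <= k <= n)%N -> \tr (A ^+ k) = \tr (B ^+ k)) ->
  char_poly A = char_poly B.
Proof.
have [s [s_n -> trA]] := eigenvalue_seq A.
have [t [t_n -> trB]] := eigenvalue_seq B.
move=> tr_eq; apply: prod_XsubC_power_sums; rewrite ?s_n ?t_n //.
  by move=> k k_n; rewrite -trA -trB tr_eq.
exact: pchar_num.
Qed.

(** Unique factorisation makes the two eigenvalue lists permutations of each other, so every
    exponent is covered, also those above the size [n]. *)
Lemma mxtrace_expr_char_poly n (A B : 'M[C]_n) k :
  char_poly A = char_poly B -> \tr (A ^+ k) = \tr (B ^+ k).
Proof.
have [s [_ -> ->]] := eigenvalue_seq A; have [t [_ -> ->]] := eigenvalue_seq B.
by move=> /prod_XsubC_eq st; apply: perm_big.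
Qed.

End Spectrum.

(** * Orbit lengths of self-maps of finite types *)

Section Orders.
Local Open Scope nat_scope.

Lemma order_dvdn (T : finType) (f : T -> T) (x : T) n :
  injective f -> iter n f x = x -> order f x %| n.
Proof.
move=> f_inj; rewrite {1}(divn_eq n (order f x)) addnC iterD.
have -> : iter (n %/ order f x * order f x) f x = x.
  by elim: (n %/ _) => // m IHm; rewrite mulSn iterD IHm iter_order.
move=> fx; apply/eqP; have lt_n := ltn_pmod n (order_gt0 f x).
by rewrite -(findex_iter lt_n) fx findex0.
Qed.

Lemma order_conj (T U : finType) (f : T -> T) (g : U -> U) (h : T -> U) x :
  injective h -> (forall y, h (f y) = g (h y)) -> order g (h x) = order f x.
Proof.
move=> h_inj hfg; rewrite /order -(card_image h_inj); apply: eq_card => u.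
have h_iter i : h (iter i f x) = iter i g (h x) by elim: i => //= i <-.
apply/idP/imageP => [/iter_findex <-|[y /iter_findex <- ->]].
  by exists (iter (findex g (h x) u) f x); rewrite ?h_iter // [_ \in _]fconnect_iter.
by rewrite h_iter [_ \in _]fconnect_iter.
Qed.

End Orders.

(** * Rotations, periods and repetitions of words *)

Section Words.
Local Open Scope nat_scope.
Variable T : finType.
Implicit Types (s x y : seq T) (r l n : nat).

Definition rep r s := flatten (nseq r s).

Lemma size_rep r s : size (rep r s) = r * size s.
Proof. by rewrite size_flatten /shape map_nseq sumn_nseq mulnC. Qed.

(** With [x] a single letter, this is what lets rotation by one commute with repetition. *)
Lemma rep_cat_comm r x y : rep r (x ++ y) ++ x = x ++ rep r (y ++ x).
Proof.
by elim: r => [|r IHr]; rewrite /rep /= ?cats0 // -!catA -/(rep r _) IHr.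
Qed.

Lemma rot1_rep r s : rot 1 (rep r s) = rep r (rot 1 s).
Proof.
case: s => [|a s]; first by rewrite /rep; elim: r.
case: r => // r; rewrite rot1_cons -cats1 /rep /= -/(rep r _) rot1_cons -cats1.
by rewrite -!catA -(rep_cat_comm r [:: a] s).
Qed.

Lemma take_rep r l s : size s = l -> 0 < r -> take l (rep r s) = s.
Proof. by case: r => // r sl _; rewrite /rep /= take_size_cat. Qed.

(** Commuting words are powers of a common word; here [size x] divides [size y], so [x] itself is
    the root, and the induction strips one copy of [x] off [y]. *)
Lemma commuting_rep k x y : x ++ y = y ++ x -> size y = k * size x -> y = rep k x.
Proof.
elim: k y => [|k IHk] y; first by move=> _ /size0nil.
move=> xy sy; have x_y : size x <= size y by rewrite sy mulSn leq_addr.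
have y_def : y = x ++ drop (size x) y.
  rewrite -[LHS](cat_take_drop (size x)); congr (_ ++ _).
  by have := congr1 (take (size x)) xy; rewrite take_size_cat // takel_cat.
move: xy; rewrite y_def -[in RHS]catA => /eqP; rewrite eqseq_cat // eqxx /= => /eqP xy.
rewrite {1}/rep /= -/(rep k x); congr (_ ++ _).
by apply: IHk => //; rewrite size_drop sy mulSn addKn.
Qed.

(** Invariance under [rot l] says that the prefix of length [l] and the rest commute. *)
Lemma rot_fixed_rep l r s : size s = r * l -> 0 < r -> rot l s = s ->
  s = rep r (take l s).
Proof.
case: r => // r s_rl _; rewrite /rot => rot_s.
have l_s : l <= size s by rewrite s_rl mulSn leq_addr.
have take_l : size (take l s) = l by rewrite size_takel.
rewrite {1}/rep /= -/(rep r _) -{1}(cat_take_drop l s); congr (_ ++ _).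
apply: commuting_rep; first by rewrite rot_s cat_take_drop.
by rewrite take_l size_drop s_rl mulSn addKn.
Qed.

Lemma cycle_rep (e : rel T) r s : 0 < r -> cycle e (rep r s) = cycle e s.
Proof.
case: s => [|a s]; first by case: r => // r _; rewrite /rep; elim: r.
case: r => // r _; rewrite /rep /= -/(rep r _).
elim: r => [|r IHr]; first by rewrite /rep cats0.
rewrite /rep /= -/(rep r _) rcons_cat cat_path /= IHr.
by rewrite rcons_path andbA andbb.
Qed.

(** Rotation as a self-map of a finite type, so that [order] counts the distinct rotations of a
    word, i.e. its least period dividing the length. *)
Definition rot1t n (t : n.-tuple T) : n.-tuple T := [tuple of rot 1 t].

Lemma rot1t_inj n : injective (@rot1t n).
Proof. by move=> t u [] /rot_inj /val_inj. Qed.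

(** The bound on [i] matters: [rot i] is the identity beyond the length, while the iterates keep
    rotating. *)
Lemma val_iter_rot1t n (t : n.-tuple T) i : i <= n ->
  val (iter i (@rot1t n) t) = rot i t.
Proof.
elim: i => [|i IHi] i_n; first by rewrite rot0.
rewrite iterS -[LHS]/(rot 1 (val (iter i (@rot1t n) t))) IHi ?(ltnW i_n) //.
by rewrite [RHS]rotS ?size_tuple.
Qed.

Lemma iter_rot1t_ex n (t : n.-tuple T) i :
  exists j, val (iter i (@rot1t n) t) = rot j t.
Proof.
elim: i => [|i [j IHi]]; first by exists 0; rewrite rot0.
by exists (rot_add t j 1); rewrite iterS -[LHS]/(rot 1 (val (iter i (@rot1t n) t))) IHi rot_rot_add.
Qed.

Lemma order_rot1t_dvdn n (t : n.-tuple T) : order (@rot1t n) t %| n.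
Proof.
apply: order_dvdn; first exact: rot1t_inj.
by apply/val_inj; rewrite val_iter_rot1t // -{1}(size_tuple t) rot_size.
Qed.

(** Closed with [Defined] so that the underlying word reduces to [rep r q]. *)
Definition rept n r l (nrl : r * l = n) (q : l.-tuple T) : n.-tuple T.
Proof. by exists (rep r q); rewrite size_rep size_tuple nrl. Defined.

Lemma order_rept n r l (nrl : r * l = n) (q : l.-tuple T) : 0 < r ->
  order (@rot1t n) (rept nrl q) = order (@rot1t l) q.
Proof.
move=> r_gt0; apply: order_conj => [u v [] /(congr1 (take l))|u].
  by rewrite !take_rep ?size_tuple // => /val_inj.
by apply/val_inj; rewrite /= rot1_rep.
Qed.

Lemma rot1t_order_rep n r l (t : n.-tuple T) :
  r * l = n -> 0 < r -> order (@rot1t n) t = l -> val t = rep r (take l t).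
Proof.
move=> nrl r_gt0 t_l; apply: rot_fixed_rep; rewrite ?size_tuple //.
rewrite -val_iter_rot1t -?nrl ?leq_pmull // -{1}t_l iter_order //.
exact: rot1t_inj.
Qed.

(** Repetition is a bijection from words of length [l] with [l] distinct rotations to words of
    length [n] with [l] distinct rotations; its inverse is [take l]. [P] and [F] live on sequences
    to make sense for both lengths. *)
Lemma big_order_rept (R : Type) (idx : R) (op : Monoid.com_law idx)
    n r l (P : pred (seq T)) (F : seq T -> R) : r * l = n -> 0 < r ->
  \big[op/idx]_(t : n.-tuple T | P t && (order (@rot1t n) t == l)) F t =
  \big[op/idx]_(q : l.-tuple T | P (rep r q) && (order (@rot1t l) q == l))
     F (rep r q).
Proof.
move=> nrl r_gt0.
have takeP (t : n.-tuple T) : size (take l t) == l.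
  by rewrite size_takel // size_tuple -nrl leq_pmull.
rewrite (reindex_onto (rept nrl) (fun t => Tuple (takeP t))) => [|t /andP[_ /eqP t_l]].
  apply: eq_bigl => q; rewrite order_rept //=.
  suff -> : Tuple (takeP (rept nrl q)) = q by rewrite eqxx andbT.
  by apply/val_inj; rewrite /= take_rep ?size_tuple.
by apply/val_inj; rewrite /= -rot1t_order_rep.
Qed.

End Words.

(** * Prime cycles as rotation orbits of closed paths *)

Section Necklaces.
Variables (R : realType) (d nu : nat) (G : fund_graph d nu).
Local Notation C := R[i].
Local Notation E := (medge G).
Implicit Types (s : seq E) (Q : 'I_nu -> C).

Lemma closed_path_rep r s : (0 < r)%N -> closed_path (rep r s) = closed_path s.
Proof. by move=> r_gt0; rewrite /closed_path size_rep muln_gt0 r_gt0 cycle_rep. Qed.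

Lemma uses_added_loop_rep r s : (0 < r)%N ->
  uses_added_loop (rep r s) = uses_added_loop s.
Proof.
by move=> r_gt0; rewrite /uses_added_loop /rep; elim: r r_gt0 => //= -[|r] IHr _;
  rewrite /= ?cats0 // has_cat IHr // orbb.
Qed.

Lemma path_weight_rep Q r s : path_weight Q (rep r s) = path_weight Q s ^+ r.
Proof.
rewrite /path_weight /rep; elim: r => [|r IHr] /=; first by rewrite big_nil.
by rewrite big_cat /= IHr exprS.
Qed.

Lemma path_index_rep r s : path_index (rep r s) = path_index s *+ r.
Proof.
rewrite /path_index /rep; elim: r => [|r IHr] /=; first by rewrite big_nil.
by rewrite big_cat /= IHr mulrS.
Qed.

Lemma closed_path_rot i s : closed_path (rot i s) = closed_path s.
Proof. by rewrite /closed_path size_rot rot_cycle. Qed.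

Lemma uses_added_loop_rot i s : uses_added_loop (rot i s) = uses_added_loop s.
Proof. by apply: eq_has_r => a; rewrite mem_rot. Qed.

Lemma path_weight_rot Q i s : path_weight Q (rot i s) = path_weight Q s.
Proof. by apply: perm_big; rewrite perm_rot. Qed.

Lemma path_index_rot i s : path_index (rot i s) = path_index s.
Proof. by apply: perm_big; rewrite perm_rot. Qed.

Lemma cycle_ofE l (t u : l.-tuple E) :
  (u \in cycle_of t) = fconnect (@rot1t E l) t u.
Proof.
rewrite inE; apply/asboolP/idP => [[i u_def]|/iter_findex <-]; last exact: iter_rot1t_ex.
have [i_l|l_i] := leqP i l.
  have -> : u = iter i (@rot1t E l) t by apply/val_inj; rewrite u_def val_iter_rot1t.
  exact: fconnect_iter.
(* An oversized rotation does nothing, so [u] is [t] itself. *)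
have -> : u = t by apply/val_inj; rewrite u_def rot_oversize // size_tuple ltnW.
exact: connect0.
Qed.

Lemma mem_cycle_of l (t u : l.-tuple E) : u \in cycle_of t -> exists i, val u = rot i t.
Proof. by rewrite inE => /asboolP. Qed.

Lemma cycle_of_eq l (t u : l.-tuple E) :
  (cycle_of u == cycle_of t) = (u \in cycle_of t).
Proof.
apply/eqP/idP => [<-|]; first by rewrite cycle_ofE connect0.
rewrite cycle_ofE => tu; apply/setP => v; rewrite !cycle_ofE.
by rewrite (same_connect (fconnect_sym (@rot1t_inj _ _)) tu).
Qed.

Lemma card_cycle_of l (t : l.-tuple E) : #|cycle_of t| = order (@rot1t E l) t.
Proof. by apply: eq_card => u; rewrite cycle_ofE. Qed.

(** A period [p < l] exhibits [t] as the [l / p]-fold repetition of its prefix of length [p];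
    conversely a proper power of [q] has at most [size q < l] distinct rotations. *)
Lemma prime_pathE l (t : l.-tuple E) :
  `[< prime_path t >] = closed_path t && (order (@rot1t E l) t == l).
Proof.
apply/asboolP/andP => [[t_closed t_prime]|[t_closed /eqP t_l]].
  split=> //; apply/negPn/negP => t_l; apply: t_prime.
  have l_gt0 : (0 < l)%N by case/andP: t_closed; rewrite size_tuple.
  set p := order _ t in t_l; have /dvdnP[r l_rp] := order_rot1t_dvdn t.
  rewrite -/p in l_rp; have r_gt0 : (0 < r)%N by case: r l_rp l_gt0 => // ->.
  have t_rep := rot1t_order_rep (esym l_rp) r_gt0 (erefl p).
  exists (take p t), r; split; last split=> //.
    case: r r_gt0 l_rp {t_rep} => [|[|r]] // _; rewrite mul1n => l_p.
    by rewrite -l_p eqxx in t_l.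
  by rewrite -(closed_path_rep _ r_gt0) -t_rep.
split=> // -[q [r [r_gt1 [q_closed t_def]]]].
have q_gt0 : (0 < size q)%N by case/andP: q_closed.
have l_rq : (r * size q = l)%N by rewrite -size_rep -(size_tuple t) t_def.
have t_rept : t = rept l_rq (in_tuple q) by apply/val_inj.
have q_l : order (@rot1t E (size q)) (in_tuple q) = l.
  by rewrite -t_l t_rept order_rept // ltnW.
have := dvdn_leq q_gt0 (order_rot1t_dvdn (in_tuple q)).
by rewrite q_l -l_rq leqNgt -{1}(mul1n (size q)) ltn_pmul2r ?r_gt1.
Qed.

(** A prime cycle of length [l] is an orbit of exactly [l] closed paths, on which [f] is constant;
    this produces the factor [l]. *)
Lemma sum_PtildeMinusP l (F : {set l.-tuple E} -> C) (f : l.-tuple E -> C) :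
  (forall t u, u \in cycle_of t -> F (cycle_of t) = f u) ->
  l%:R * \sum_(c in PtildeMinusP G l) F c =
  \sum_(t : l.-tuple E | [&& closed_path t, uses_added_loop t &
                             order (@rot1t E l) t == l]) f t.
Proof.
move=> Ff; rewrite /PtildeMinusP; set D := [set t | _].
have inD t : (t \in D) =
    [&& closed_path t, uses_added_loop t & order (@rot1t E l) t == l].
  by rewrite inE prime_pathE -!andbA; do 2 congr (_ && _); rewrite andbC.
rewrite -(eq_bigl _ _ inD) [RHS](partition_big_imset (@cycle_of _ _ G l)) mulr_sumr.
apply: eq_bigr => _ /imsetP[t tD ->].
rewrite (eq_bigl (fun u => u \in cycle_of t)) => [|u]; last first.
  rewrite cycle_of_eq; have [ut|] := boolP (u \in cycle_of t); last by rewrite andbF.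
  rewrite andbT.
  have [i u_rot] := mem_cycle_of ut; move: tD; rewrite !inD.
  case/and3P=> t_cl t_loop t_l.
  rewrite u_rot closed_path_rot uses_added_loop_rot t_cl t_loop -card_cycle_of.
  by rewrite (eqP (_ : cycle_of u == cycle_of t)) ?cycle_of_eq // card_cycle_of.
rewrite (eq_bigr (fun=> F (cycle_of t))) => [|u ut]; last by rewrite (Ff _ _ ut).
rewrite sumr_const card_cycle_of.
by move: tD; rewrite inD => /and3P[_ _ /eqP ->]; rewrite mulr_natl.
Qed.

(** The class contains [t], so the default [a] is never returned, and invariance makes the picked
    representative irrelevant. *)
Lemma pick_cycle_of l (t : l.-tuple E) (A : Type) (f : l.-tuple E -> A) (a : A) u :
  (forall u, u \in cycle_of t -> f u = f t) -> u \in cycle_of t ->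
  (if [pick v in cycle_of t] is Some v then f v else a) = f u.
Proof.
move=> ft ut; case: pickP => [v vt|/(_ t)]; first by rewrite (ft v vt) (ft u ut).
by rewrite cycle_ofE connect0.
Qed.

Lemma cycle_weight_of Q l (t u : l.-tuple E) : u \in cycle_of t ->
  cycle_weight Q (cycle_of t) = path_weight Q u.
Proof.
apply: (pick_cycle_of (f := fun t : l.-tuple E => path_weight Q t)) => v.
by case/mem_cycle_of => i ->; rewrite path_weight_rot.
Qed.

Lemma cycle_index_of l (t u : l.-tuple E) : u \in cycle_of t ->
  cycle_index (cycle_of t) = path_index u.
Proof.
apply: (pick_cycle_of (f := fun t : l.-tuple E => path_index t)) => v.
by case/mem_cycle_of => i ->; rewrite path_index_rot.
Qed.

(** The predicate on the index treats both systems at once: [pred1 m] for the Floquet invariants,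
    [xpredT] for the periodic ones. *)
Definition loop_sum n (P : pred 'rV[int]_d) Q : C :=
  \sum_(t : n.-tuple E | [&& closed_path t, uses_added_loop t & P (path_index t)])
     path_weight Q t.

Definition prime_cycle_sum n (P : pred 'rV[int]_d) Q : C :=
  \sum_(r < n.+1 | (0 < r)%N) \sum_(l < n.+1 | (r * l == n)%N)
     \sum_(c in PtildeMinusP G l | P (cycle_index c *~ r))
        (r%:R)^-1 * cycle_weight Q c ^+ r.

(** Closed paths are sorted by their number [l] of distinct rotations. It divides [n], which forces
    [r = n / l], and the factor [n / r = l] counts the representatives of each prime cycle. *)
Lemma prime_cycle_sumE n P Q :
  n%:R * prime_cycle_sum n P Q = loop_sum n P Q.
Proof.
have [->|n_gt0] := posnP n.
  by rewrite mul0r /loop_sum big1 // => t /andP[/andP[]]; rewrite size_tuple.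
rewrite /prime_cycle_sum (exchange_big_dep xpredT) //= mulr_sumr.
rewrite /loop_sum; pose ord (t : n.-tuple E) : 'I_n.+1 := inord (order (@rot1t E n) t).
have ordE t : ord t = order (@rot1t E n) t :> nat.
  by rewrite inordK // ltnS dvdn_leq // order_rot1t_dvdn.
rewrite (partition_big ord xpredT) //=; apply: eq_bigr => l _.
have [l_n|l_n] := boolP (l %| n)%N; last first.
  rewrite !big_pred0 ?mulr0 // => [t|r]; last first.
    by apply/negP => /andP[_ /eqP n_def]; case/negP: l_n; apply/dvdnP; exists r.
  rewrite -val_eqE /= ordE; apply/negP => /andP[_ /eqP t_l]; case/negP: l_n.
  by rewrite -t_l order_rot1t_dvdn.
have l_gt0 : (0 < l)%N by apply: dvdn_gt0 l_n.
have nrl : (n %/ l * l = n)%N by rewrite divnK.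
have r_gt0 : (0 < n %/ l)%N by rewrite divn_gt0 // dvdn_leq.
have r_n : (n %/ l < n.+1)%N by rewrite ltnS leq_div.
rewrite (big_pred1 (Ordinal r_n)) => [|r]; last first.
  rewrite /= -val_eqE /= -eqn_div //.
  by apply: andb_idl => /eqP ->.
set r := (n %/ l)%N in nrl r_gt0 r_n *; rewrite /=.
under [RHS]eq_bigl => t do rewrite -val_eqE /= ordE.
rewrite (big_order_rept _
  (fun s => [&& closed_path s, uses_added_loop s & P (path_index s)])
  (path_weight Q) nrl r_gt0).
have -> : n%:R = r%:R * l%:R :> C by rewrite -natrM nrl.
(* The index condition moves into the summand, so that the sum runs over all of
   [PtildeMinusP G l]. *)
rewrite -mulrA big_mkcondr.
rewrite (sum_PtildeMinusP (f := fun u => if P (path_index u *+ r)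
    then r%:R^-1 * path_weight Q u ^+ r else 0)) => [|t u ut]; last first.
  by rewrite (cycle_weight_of _ ut) (cycle_index_of ut).
rewrite mulr_sumr big_mkcond [RHS]big_mkcond; apply: eq_bigr => q _.
rewrite closed_path_rep // uses_added_loop_rep // path_index_rep path_weight_rep.
case: (closed_path q) => //=; case: (uses_added_loop q) => //=.
case: (_ == l :> nat); rewrite ?andbF ?andbT //; case: P; rewrite ?mulr0 //.
by rewrite mulVKf // pnatr_eq0 -lt0n.
Qed.

End Necklaces.

(** * Powers of a weighted adjacency matrix as sums over walks *)

Section Walks.
Variables (K : comNzRingType) (nu : nat) (E : finType) (src tgt : E -> 'I_nu).
Variable g : E -> K.
Implicit Types (a : E) (s : seq E) (u v : 'I_nu).

Let M : 'M[K]_nu := \matrix_(v, u) \sum_(a | (src a == v) && (tgt a == u)) g a.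

(** The start vertex is an explicit argument so that the empty walk joins [v] only to itself,
    matching [M ^+ 0]. *)
Fixpoint walk v s u : bool :=
  if s is a :: s' then (src a == v) && walk (tgt a) s' u else v == u.

Lemma walk_path a s u :
  walk (tgt a) s u = path (fun a b => tgt a == src b) a s && (tgt (last a s) == u).
Proof. by elim: s a => //= b s IHs a; rewrite IHs andbA eq_sym. Qed.

Lemma big_tupleS n (F : seq E -> K) :
  \sum_(t : n.+1.-tuple E) F t = \sum_a \sum_(t : n.-tuple E) F (a :: t).
Proof.
rewrite pair_big (reindex_onto (fun p : E * n.-tuple E => [tuple of p.1 :: p.2])
  (fun t => (thead t, [tuple of behead t]))) => [|t _]; last first.
  by rewrite [RHS]tuple_eta.
apply: eq_bigl => -[a t] /=; rewrite xpair_eqE theadE eqxx /=.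
by apply/eqP/val_inj.
Qed.

Lemma expr_walk_mx n v u :
  (M ^+ n) v u = \sum_(t : n.-tuple E | walk v t u) \prod_(a <- t) g a.
Proof.
elim: n v u => [|n IHn] v u.
  rewrite expr0 mxE big_mkcond (big_pred1 [tuple]) => [|t]; last first.
    by rewrite (tuple0 t) /= eqxx.
  by rewrite /= big_nil; case: eqP.
rewrite exprS mxE [RHS]big_mkcond.
rewrite (big_tupleS n (fun s => if walk v s u then \prod_(a <- s) g a else 0)).
under eq_bigr => w do rewrite mxE mulr_suml.
rewrite (exchange_big_dep xpredT) //=; apply: eq_bigr => a _.
have [src_v|src_v] := eqVneq (src a) v; last first.
  by rewrite !big1 // => t _; rewrite (negbTE src_v).
rewrite (big_pred1 (tgt a)) => [|w]; last by rewrite /= eq_sym.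
rewrite IHn mulr_sumr big_mkcond; apply: eq_bigr => t _.
by rewrite big_cons.
Qed.

(** At [n = 0] the trace would be [nu], whereas the empty word counts once. *)
Lemma mxtrace_expr_walk n : (0 < n)%N ->
  \tr (M ^+ n) =
  \sum_(t : n.-tuple E | cycle (fun a b => tgt a == src b) t) \prod_(a <- t) g a.
Proof.
case: n => // n _; rewrite /mxtrace.
under eq_bigr => v do rewrite expr_walk_mx big_mkcond.
rewrite exchange_big /= [RHS]big_mkcond; apply: eq_bigr => t _.
case/tupleP: t => a t /=; rewrite rcons_path.
rewrite (bigD1 (src a)) //= eqxx walk_path [X in _ + X]big1 ?addr0 // => v /negbTE.
by rewrite eq_sym => ->.
Qed.

End Walks.

(** * Linear independence of the characters indexed by integer vectors *)

Section Characters.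
Variables (R : realType) (d : nat).
Local Notation C := R[i].
Implicit Types (m : 'rV[int]_d) (k h : 'rV[R]_d).

Lemma expi0 : expi 0 = 1 :> C.
Proof. by rewrite /expi cos0 sin0. Qed.

Lemma expiD (x y : R) : expi (x + y) = expi x * expi y.
Proof.
rewrite /expi cosD sinD; apply/eqP; rewrite eq_complex /= eqxx /=.
by rewrite addrC [X in _ + X]mulrC [X in X + _]mulrC eqxx.
Qed.

Lemma expi_dotDl m1 m2 k :
  expi (dotZR (m1 + m2) k) = expi (dotZR m1 k) * expi (dotZR m2 k).
Proof.
rewrite -expiD /dotZR -big_split; congr expi; apply: eq_bigr => i _.
by rewrite mxE intrD mulrDl.
Qed.

Lemma expi_dotDr m k h :
  expi (dotZR m (k + h)) = expi (dotZR m k) * expi (dotZR m h).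
Proof.
rewrite -expiD /dotZR -big_split; congr expi; apply: eq_bigr => i _.
by rewrite mxE mulrDr.
Qed.

Lemma expi_dot0l k : expi (dotZR 0 k) = 1.
Proof. by rewrite /dotZR big1 ?expi0 // => i _; rewrite mxE mul0r. Qed.

Lemma expi_dot0r m : expi (dotZR m (0 : 'rV[R]_d)) = 1.
Proof. by rewrite /dotZR big1 ?expi0 // => i _; rewrite mxE mulr0. Qed.

Lemma expi_dot_inj m1 m2 :
  (forall k : 'rV[R]_d, expi (dotZR m1 k) = expi (dotZR m2 k)) -> m1 = m2.
Proof.
move=> m12; apply/rowP => i; apply/eqP; rewrite -subr_eq0; apply/negPn/negP => mi.
pose x : R := (m1 0 i - m2 0 i)%:~R; have x_nz : x != 0 by rewrite intr_eq0.
(* At this [k] the two characters differ by the factor [expi pi = -1]. *)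
pose k : 'rV[R]_d := \row_j (if j == i then pi / x else 0).
have dotk m : dotZR m k = (m 0 i)%:~R * (pi / x).
  rewrite /dotZR (bigD1 i) //= mxE eqxx big1 ?addr0 // => j ji.
  by rewrite mxE (negbTE ji) mulr0.
have := m12 k; rewrite !dotk.
have -> : (m1 0 i)%:~R = x + (m2 0 i)%:~R :> R by rewrite /x intrB subrK.
rewrite mulrDl expiD mulrCA divff // mulr1.
move/eqP; rewrite -subr_eq0 -[X in _ - X]mul1r -mulrBl mulf_eq0.
case/orP => [|].
  rewrite /expi cospi sinpi subr_eq0 eq_complex /= => /andP[/eqP H _].
  by have := ltr01 (R := R); rewrite -H oppr_gt0 ltr10.
rewrite /expi eq_complex /= => /andP[/eqP c0 /eqP s0].
have /eqP := cos2Dsin2 ((m2 0 i)%:~R * (pi / x)).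
by rewrite c0 s0 expr0n addr0 eq_sym oner_eq0.
Qed.

(* Artin's argument: comparing the relation at [k + h] with [expi (dotZR m0 h)]
   times the relation at [k] eliminates [m0]. *)
Lemma expi_dot_free (s : seq 'rV[int]_d) (c : 'rV[int]_d -> C) : uniq s ->
    (forall k, \sum_(m <- s) c m * expi (dotZR m k) = 0) ->
  {in s, forall m, c m = 0}.
Proof.
elim: s c => // m0 s IHs c /andP[m0_s s_uniq] c_rel.
have cs : {in s, forall m, c m = 0}.
  move=> m m_s; apply/eqP/negPn/negP => cm; case/negP: m0_s.
  suff <- : m = m0 by [].
  apply: expi_dot_inj => h; apply/eqP; rewrite -subr_eq0.
  suff : c m * (expi (dotZR m h) - expi (dotZR m0 h)) = 0.
    by move/eqP; rewrite mulf_eq0 (negbTE cm).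
  apply: (IHs (fun m => c m * (expi (dotZR m h) - expi (dotZR m0 h)))) => // k.
  have : \sum_(m' <- m0 :: s)
      c m' * (expi (dotZR m' h) - expi (dotZR m0 h)) * expi (dotZR m' k) = 0.
    transitivity (\sum_(m' <- m0 :: s) c m' * expi (dotZR m' (k + h)) -
        expi (dotZR m0 h) * \sum_(m' <- m0 :: s) c m' * expi (dotZR m' k)).
      rewrite mulr_sumr -sumrB; apply: eq_bigr => m' _.
      rewrite expi_dotDr mulrBr mulrBl [c m' * _ * _]mulrAC -mulrA; congr (_ - _).
      by rewrite mulrAC mulrC.
    by rewrite !c_rel mulr0 subr0.
  by rewrite big_cons subrr mulr0 mul0r add0r.
move=> m; rewrite inE => /orP[/eqP ->|]; last exact: cs.
have := c_rel 0; rewrite big_cons expi_dot0r mulr1 big_seq big1 ?addr0 // => m' m'_s.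
by rewrite cs ?mul0r.
Qed.

End Characters.

(** * Traces of powers of the Floquet matrices *)

Section FloquetTraces.
Variables (R : realType) (d nu : nat) (G : fund_graph d nu).
Local Notation C := R[i].
Local Notation E := (medge G).
Implicit Types (Q : 'I_nu -> C) (k : 'rV[R]_d) (n : nat).

(** The added loop at [v] has index 0, hence character 1, and contributes exactly the diagonal entry
    [Q v]. *)
Lemma floquetHE Q k : floquetH G Q k =
  \matrix_(v, u) \sum_(a : E | (msrc a == v) && (mtgt a == u))
     mweight Q a * expi (dotZR (mtau a) k).
Proof.
apply/matrixP => v u; rewrite !mxE big_sumType /=; congr (_ + _).
  by apply: eq_bigr => e _; rewrite mul1r.
under eq_bigr do rewrite expi_dot0l mulr1.
have [->|vu] := eqVneq v u.
  by rewrite mul1r (big_pred1 u) // => w; rewrite andbb.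
rewrite mul0r big_pred0 // => w; apply/negP => /andP[/eqP wv /eqP wu].
by rewrite -wv wu eqxx in vu.
Qed.

Lemma prod_mweight Q k (s : seq E) :
  \prod_(a <- s) (mweight Q a * expi (dotZR (mtau a) k)) =
  path_weight Q s * expi (dotZR (path_index s) k).
Proof.
rewrite big_split; congr (_ * _); rewrite /path_index.
by elim/big_rec2: _ => [|a x m _ ->]; rewrite ?expi_dot0l ?expi_dotDl.
Qed.

Lemma mxtrace_floquetH Q k n : (0 < n)%N ->
  \tr (floquetH G Q k ^+ n) =
  \sum_(t : n.-tuple E | closed_path t) path_weight Q t * expi (dotZR (path_index t) k).
Proof.
move=> n_gt0; rewrite floquetHE mxtrace_expr_walk //; apply: eq_big => [t|t _].
  by rewrite /closed_path size_tuple n_gt0.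
exact: prod_mweight.
Qed.

Lemma path_weight_no_loop Q1 Q2 (s : seq E) : ~~ uses_added_loop s ->
  path_weight Q1 s = path_weight Q2 s.
Proof.
move=> s_loop; apply: eq_big_seq => -[e|v] //= v_s.
by case/hasP: s_loop; exists (inr v).
Qed.

Definition loop_trace n k Q : C :=
  \sum_(t : n.-tuple E | closed_path t && uses_added_loop t)
     path_weight Q t * expi (dotZR (path_index t) k).

Lemma mxtrace_floquetH_eq Q1 Q2 k n : (0 < n)%N ->
  \tr (floquetH G Q1 k ^+ n) = \tr (floquetH G Q2 k ^+ n) <->
  loop_trace n k Q1 = loop_trace n k Q2.
Proof.
move=> n_gt0; rewrite !mxtrace_floquetH //.
pose loop (t : n.-tuple E) := uses_added_loop t.
rewrite (bigID loop) [X in _ = X](bigID loop) /=.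
rewrite (eq_bigr (P := fun t => closed_path _ && ~~ loop t)
  (fun t : n.-tuple E => path_weight Q2 t * expi (dotZR (path_index t) k)))
  => [|t /andP[_ t_loop]].
  by rewrite -!/(loop_trace _ _ _); split=> [/addIr|->].
by rewrite (path_weight_no_loop Q1 Q2 t_loop).
Qed.

(** A finite list containing every index that can occur, making the Fourier sum over integer vectors
    finite; it is duplicate-free, as linear independence requires. *)
Definition path_indices n : seq 'rV[int]_d :=
  undup [seq path_index t | t : n.-tuple E].

Lemma loop_traceE n k Q : loop_trace n k Q =
  \sum_(m <- path_indices n) loop_sum G n (pred1 m) Q * expi (dotZR m k).
Proof.
under [RHS]eq_bigr do rewrite mulr_suml.
rewrite (exchange_big_dep (fun t : n.-tuple E =>
  closed_path t && uses_added_loop t)) /= => [|m t _ /and3P[-> ->] //].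
apply: eq_bigr => t t_ok.
case/andP: t_ok => -> ->; rewrite -big_filter /=.
under eq_filter => m do rewrite eq_sym.
rewrite filter_pred1_uniq ?undup_uniq ?big_seq1 //.
by rewrite mem_undup; apply: image_f.
Qed.

Lemma loop_trace_eq n Q1 Q2 :
  (forall k, loop_trace n k Q1 = loop_trace n k Q2) <->
  (forall m, loop_sum G n (pred1 m) Q1 = loop_sum G n (pred1 m) Q2).
Proof.
split=> [tr12 m|sum12 k]; last first.
  by rewrite !loop_traceE; apply: eq_bigr => m _; rewrite sum12.
have [m_n|m_n] := boolP (m \in path_indices n); last first.
  (* An index outside the list is attained by no path, so both sums are empty. *)
  rewrite /loop_sum !big_pred0 // => t; apply/negP => /and3P[_ _ /eqP tm];
  by case/negP: m_n; rewrite -tm mem_undup; apply: image_f.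
apply/eqP; rewrite -subr_eq0; apply/eqP; move: m m_n.
apply: (expi_dot_free (c := fun m => _ - _)) => [|k]; first exact: undup_uniq.
under eq_bigr do rewrite mulrBl.
by rewrite sumrB -!loop_traceE tr12 subrr.
Qed.

Lemma loop_trace0 n Q : loop_trace n 0 Q = loop_sum G n xpredT Q.
Proof. by apply: eq_big => [t|t _]; rewrite ?andbT // expi_dot0r mulr1. Qed.

Lemma prime_cycle_sum_eq n P Q1 Q2 : (0 < n)%N ->
  prime_cycle_sum G n P Q1 = prime_cycle_sum G n P Q2 <->
  loop_sum G n P Q1 = loop_sum G n P Q2.
Proof.
move=> n_gt0; rewrite -!prime_cycle_sumE; split=> [->//|].
by apply: mulfI; rewrite pnatr_eq0 -lt0n.
Qed.

Lemma prime_cycle_sum0 P Q : prime_cycle_sum G 0 P Q = 0.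
Proof. by rewrite /prime_cycle_sum big_pred0 // => -[[]]. Qed.

Lemma invI_prime_cycle_sum n Q : invI G n Q = prime_cycle_sum G n xpredT Q.
Proof.
by do 2 (apply: eq_bigr => ? _); apply: eq_bigl => c; rewrite andbT.
Qed.

Lemma loop_trace_same_spectrum k Q1 Q2 n : (0 < n)%N ->
  same_spectrum (floquetH G Q1 k) (floquetH G Q2 k) ->
  loop_trace n k Q1 = loop_trace n k Q2.
Proof.
move=> n_gt0 Q12; apply/mxtrace_floquetH_eq => //.
exact: mxtrace_expr_char_poly.
Qed.

Lemma same_spectrum_loop_trace k Q1 Q2 :
  (forall n, (1 <= n <= nu)%N -> loop_trace n k Q1 = loop_trace n k Q2) ->
  same_spectrum (floquetH G Q1 k) (floquetH G Q2 k).
Proof.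
move=> Q12; apply: char_poly_eq_mxtrace_expr => n n_nu.
by apply/mxtrace_floquetH_eq; [case/andP: n_nu | apply: Q12].
Qed.

End FloquetTraces.

Theorem theorem2p5 (R : realType) (d nu : nat) (G : fund_graph d nu) :
  (0 < d)%N -> periodic_graph_axioms G ->
  [/\ (* (i) each I_n^m is a Floquet spectral invariant *)
      (forall (n : nat) (m : 'rV[int]_d) (Q1 Q2 : 'I_nu -> R[i]),
          floquet_isospectral G Q1 Q2 -> invI_m G n m Q1 = invI_m G n m Q2),
      (* (i) completeness of {I_n^m : 1 <= n <= nu, m in Z^d} *)
      (forall Q1 Q2 : 'I_nu -> R[i],
          floquet_isospectral G Q1 Q2 <->
          (forall (n : nat) (m : 'rV[int]_d), (1 <= n <= nu)%N ->
              invI_m G n m Q1 = invI_m G n m Q2)),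
      (* (ii) each I_n is a periodic spectral invariant *)
      (forall (n : nat) (Q1 Q2 : 'I_nu -> R[i]),
          periodic_isospectral G Q1 Q2 -> invI G n Q1 = invI G n Q2) &
      (* (ii) completeness of {I_n : 1 <= n <= nu} *)
      (forall Q1 Q2 : 'I_nu -> R[i],
          periodic_isospectral G Q1 Q2 <->
          (forall n : nat, (1 <= n <= nu)%N -> invI G n Q1 = invI G n Q2))].
Proof.
move=> _ _.
have invI_mE n m Q : invI_m G n m Q = prime_cycle_sum (R := R) G n (pred1 m) Q by [].
have floquet_inv n m (Q1 Q2 : 'I_nu -> R[i]) :
    floquet_isospectral G Q1 Q2 -> invI_m G n m Q1 = invI_m G n m Q2.
  move=> Q12; rewrite !invI_mE.
  (* At [n = 0] there is no admissible [r] and both sides vanish. *)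
  have [->|n_gt0] := posnP n; first by rewrite !prime_cycle_sum0.
  apply/prime_cycle_sum_eq => //; move: m; apply/loop_trace_eq => k.
  exact: loop_trace_same_spectrum.
have periodic_inv n (Q1 Q2 : 'I_nu -> R[i]) :
    periodic_isospectral G Q1 Q2 -> invI G n Q1 = invI G n Q2.
  move=> Q12; rewrite !invI_prime_cycle_sum.
  have [->|n_gt0] := posnP n; first by rewrite !prime_cycle_sum0.
  apply/prime_cycle_sum_eq; rewrite -?loop_trace0 //.
  by apply: loop_trace_same_spectrum.
split=> // Q1 Q2; split=> [Q12 n *|Q12].
- exact: floquet_inv.
(* [k] is generalised again once [n] is fixed: equality for all [k] is traded for equality for all
   [m], one [n] at a time. *)
- move=> k; apply: same_spectrum_loop_trace => n n_nu; move: k.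
  apply/loop_trace_eq => m.
  by apply/prime_cycle_sum_eq; [case/andP: n_nu | rewrite -!invI_mE Q12].
- exact: periodic_inv.
apply: same_spectrum_loop_trace => n n_nu; rewrite !loop_trace0.
by apply/prime_cycle_sum_eq; [case/andP: n_nu | rewrite -!invI_prime_cycle_sum Q12].
Qed.
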